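(* Let $k\ge 2$ and $r\ge 1$ be integers with $r\le k$. Then $$\sum_{s\mid (k,r)}\binom{k/s}{r/s}\varphi(s)\equiv 0\pmod{k},$$ where the sum is over all positive divisors $s$ of the greatest common divisor $(k,r)$.
   Context: $(k,r)$ denotes the greatest common divisor of $k$ and $r$, and $\varphi$ the Euler totient function. *)

(* Defs.v *)
From mathcomp Require Export all_boot.

(* Main.v *)
Require Import Defs.
From mathcomp Require Import all_boot.
From mathcomp Require Import all_fingroup zmodp cyclic.

(** Burnside's lemma for the cyclic group of order [k] translating its own
    [r]-subsets: an element of order [s] fixes exactly the [r]-subsets that are
    unions of cosets of the subgroup of order [s], which number
    [binom(k/s, r/s)] if [s] divides [r] and [0] otherwise, and there are
    [phi(s)] such elements. The sum is thus [k] times the number of orbits. *)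

(** Blocks are nonempty and pairwise disjoint, so any point of a block identifies it: a union of
    blocks remembers which blocks it is made of. *)
Lemma cover_inj (T : finType) (P : {set {set T}}) (D : {set T}) :
  partition P D -> {in powerset P &, injective cover}.
Proof.
move=> /and3P[_ tiP P0].
suff sub (Q R : {set {set T}}) : Q \subset P -> R \subset P -> cover Q = cover R -> Q \subset R.
  move=> Q R /[!inE] sQ sR eQR; apply/eqP.
  by rewrite eqEsubset (sub Q R) // (sub R Q).
move=> /subsetP sQ /subsetP sR eQR; apply/subsetP=> A QA.
have PA := sQ A QA.
have /set0Pn[x Ax] : A != set0 by apply: contraNneq P0 => <-.
have /bigcupP[B RB Bx] : x \in cover R by rewrite -eQR; apply/bigcupP; exists A.
by rewrite -(def_pblock tiP PA Ax) (def_pblock tiP (sR B RB) Bx).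
Qed.

Section CosetUnions.

Local Open Scope group_scope.

Variables (gT : finGroupType) (H : {group gT}).

Lemma lcosets_partitionT : partition (lcosets H setT) [set: gT].
Proof.
(* The orbit of [x] under right translation by [H] is the left coset [x *: H], and orbits form a
   partition. *)
have -> : lcosets H setT = orbit 'R H @: [set: gT].
  apply/setP=> A; apply/lcosetsP/imsetP => -[x _ ->]; by exists x; rewrite ?orbitR.
by apply: orbit_partition; apply/actsP=> a _ x; rewrite !inE.
Qed.

Lemma stable_cover_lcosets (B : {set gT}) :
  B * H = B -> cover (lcosets H B) = B.
Proof.
move=> BH; apply/setP=> x; apply/bigcupP/idP => [[_ /lcosetsP[y By ->]] xy|Bx].
  by rewrite -BH; apply: subsetP xy; rewrite mulSg // sub1set.
by exists (x *: H); [apply/lcosetsP; exists x | apply: lcoset_refl].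
Qed.

Lemma cover_lcosets_stable (Q : {set {set gT}}) :
  Q \subset lcosets H setT -> cover Q * H = cover Q.
Proof.
move=> /subsetP sQ; apply/eqP; rewrite eqEsubset mulG_subl andbT.
apply/subsetP=> _ /mulsgP[x h /bigcupP[A QA Ax] Hh ->].
apply/bigcupP; exists A => //; have /lcosetsP[y _ defA] := sQ A QA.
rewrite defA in Ax *.
case/lcosetP: Ax => z Hz ->; rewrite -mulgA; apply/lcosetP.
by exists (z * h); rewrite ?groupM.
Qed.

Lemma card_cover_lcosets (Q : {set {set gT}}) :
  Q \subset lcosets H setT -> #|cover Q| = (#|Q| * #|H|)%N.
Proof.
move=> sQ; have /and3P[_ tiP _] := lcosets_partitionT.
have /eqnP <- := trivIsetS sQ tiP; rewrite -sum_nat_const.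
by apply: eq_bigr => A /(subsetP sQ)/lcosetsP[x _ ->]; rewrite card_lcoset.
Qed.

(** [B * H = B] means that [B] is a union of left cosets of [H]. Hence [cover] is a bijection onto
    these [B] from the sets [Q] of cosets with [#|Q| * #|H| = r]. *)
Lemma card_stable_draws (r : nat) :
  #|[set B : {set gT} | (B * H == B) && (#|B| == r)]| =
    if #|H| %| r then 'C(#|gT| %/ #|H|, r %/ #|H|) else 0%N.
Proof.
have H_gt0 := cardG_gt0 H.
pose P := lcosets H [set: gT].
pose F := [set Q : {set {set gT}} | (Q \subset P) && (#|Q| * #|H| == r)%N].
have -> : [set B : {set gT} | (B * H == B) && (#|B| == r)] = cover @: F.
  apply/setP=> B; rewrite inE; apply/andP/imsetP => [[/eqP BH /eqP Br]|[Q]].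
    have sBP : lcosets H B \subset P by apply: imsetS; apply: subsetT.
    exists (lcosets H B); last by rewrite stable_cover_lcosets.
    by rewrite inE sBP -card_cover_lcosets // stable_cover_lcosets // Br eqxx.
  rewrite inE => /andP[sQ /eqP Qr] ->.
  by rewrite cover_lcosets_stable // card_cover_lcosets // Qr !eqxx.
rewrite card_in_imset; last first.
  move=> Q R /[!inE] /andP[sQ _] /andP[sR _].
  by apply: (cover_inj _ _ _ lcosets_partitionT); rewrite inE.
case: ifP => [r_dvd|/negP r_ndvd]; last first.
  apply/eqP; rewrite cards_eq0 -subset0; apply/subsetP=> Q.
  by rewrite inE => /andP[_ /eqP rE]; case: r_ndvd; rewrite -rE dvdn_mull.
have -> : (#|gT| %/ #|H|)%N = #|P|.
  by rewrite card_lcosets -divgS ?subsetT // cardsT.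
rewrite -cards_draws; congr #|pred_of_set _|; apply/setP=> Q; rewrite !inE.
by rewrite -[in RHS](eqn_pmul2r H_gt0) divnK.
Qed.

End CosetUnions.

Section Translations.

Local Open Scope group_scope.

Variable gT : finGroupType.

(** Turns being fixed by one translation into being a union of cosets of [<[a]>]. Forward, apply [a]
    repeatedly; backward, [B :* a] lies in [B] and has the same size. *)
Lemma rcoset_stable_cycle (a : gT) (B : {set gT}) :
  (B :* a == B) = (B * <[a]> == B).
Proof.
apply/eqP/eqP=> [Ba|BH].
  apply/eqP; rewrite eqEsubset mulG_subl andbT.
  apply/subsetP=> _ /mulsgP[x _ Bx /cycleP[i ->] ->].
  elim: i x Bx => [|i IHi] x Bx; first by rewrite mulg1.
  by rewrite expgS mulgA; apply: IHi; rewrite -Ba mem_mulg ?inE.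
apply/eqP; rewrite eqEcard card_rcoset leqnn andbT -{2}BH mulgS //.
by rewrite sub1set cycle_id.
Qed.

Lemma sum_binomial_order_dvd (r : nat) :
  #|gT| %| \sum_(a : gT)
             if #[a] %| r then 'C(#|gT| %/ #[a], r %/ #[a]) else 0.
Proof.
pose S := [set B : {set gT} | #|B| == r].
have actsS : [acts [set: gT], on S | 'Rs].
  by apply/actsP=> a _ B; rewrite !inE /= rcosetE card_rcoset.
(* Burnside's lemma for right translation on the [r]-subsets. *)
have := Frobenius_Cauchy actsS; rewrite cardsT => sumE.
apply/dvdnP; exists #|orbit 'Rs [set: gT] @: S|; rewrite -sumE.
apply: eq_big => [a|a _]; first by rewrite inE.
rewrite -card_stable_draws; congr #|pred_of_set _|.
by apply/setP=> B; rewrite !inE sub1set inE /= rcosetE rcoset_stable_cycle andbC.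
Qed.

Lemma card_order_cyclic (s : nat) :
  cyclic [set: gT] -> s %| #|gT| -> #|[set a : gT | #[a] == s]| = totient s.
Proof.
case/cyclicP=> x defG s_dvd.
have ox : #[x] = #|gT| by rewrite orderE -defG cardsT.
have s_gt0 : 0 < s by rewrite (dvdn_gt0 _ s_dvd) // -ox order_gt0.
pose y := x ^+ (#|gT| %/ s).
have oy : #[y] = s.
  by rewrite orderXdiv ?ox ?dvdn_div // divnA ?mulKn // -ox order_gt0.
rewrite -{2}oy totient_gen; congr #|pred_of_set _|; apply/setP=> a; rewrite !inE.
have cycG : cyclic [set: gT] by rewrite defG cycle_cyclic.
(* A cyclic group has at most one subgroup of each order, so the elements of order [s] are exactly
   the generators of [<[y]>]. *)
by rewrite /generator (eq_subG_cyclic cycG) ?subsetT // -!orderE oy eq_sym.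
Qed.

Lemma sum_order_cyclic (f : nat -> nat) : cyclic [set: gT] ->
  \sum_(a : gT) f #[a] = \sum_(s <- divisors #|gT|) f s * totient s.
Proof.
move=> cycG; have G_gt0 : 0 < #|gT| by rewrite -cardsT cardG_gt0.
(* Each term becomes a one-term sum over [s = #[a]], so that exchanging the sums groups the elements
   by order. *)
transitivity (\sum_(a : gT) \sum_(s <- divisors #|gT| | s == #[a]) f s).
  apply: eq_bigr => a _.
  rewrite -big_filter filter_pred1_uniq ?divisors_uniq ?big_seq1 //.
  by rewrite -dvdn_divisors // -cardsT order_dvdG ?inE.
rewrite (exchange_big_dep xpredT) //= big_seq [RHS]big_seq.
apply: eq_bigr => s; rewrite -dvdn_divisors // => s_dvd.
rewrite sum_nat_const mulnC -card_order_cyclic //; congr (_ * _)%N.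
by apply: eq_card => a; rewrite !inE eq_sym.
Qed.

End Translations.

Theorem corollary2 (k r : nat) (hk : 2 <= k) (hr : 1 <= r) (hrk : r <= k) :
  \sum_(s <- divisors (gcdn k r)) 'C(k %/ s, r %/ s) * totient s = 0 %[mod k].
Proof.
have k_gt0 : 0 < k by apply: ltnW.
(* ['Z_k] is by definition an ordinal type of size at least 2; its size is [k] because [2 <= k]. *)
have cardZ : #|'Z_k| = k by rewrite card_ord Zp_cast.
have cycZ : cyclic [set: 'Z_k] by apply/cyclicP; exists Zp1; apply: Zp_cycle.
have := sum_binomial_order_dvd 'Z_k r.
rewrite (sum_order_cyclic _ (fun s =>
  if s %| r then 'C(#|'Z_k| %/ s, r %/ s) else 0) cycZ) cardZ.
(* The divisors of [gcdn k r] are the divisors of [k] that divide [r]; the other divisors of [k]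
   contribute 0. *)
suff <- : \sum_(s <- divisors (gcdn k r)) 'C(k %/ s, r %/ s) * totient s =
    \sum_(s <- divisors k)
      (if s %| r then 'C(k %/ s, r %/ s) else 0) * totient s.
  by move=> /eqP ->; rewrite mod0n.
have -> : \sum_(s <- divisors k)
      (if s %| r then 'C(k %/ s, r %/ s) else 0) * totient s =
    \sum_(s <- divisors k | s %| r) 'C(k %/ s, r %/ s) * totient s.
  by rewrite [RHS]big_mkcond; apply: eq_bigr => s _; case: ifP.
rewrite -[RHS]big_filter; apply: perm_big; apply: uniq_perm.
- exact: divisors_uniq.
- by rewrite filter_uniq ?divisors_uniq.
by move=> s; rewrite mem_filter -!dvdn_divisors ?gcdn_gt0 ?k_gt0 // dvdn_gcd andbC.
Qed.
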